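(* Let $(P,\preceq,\wedge)$ be a meet semilattice and let $f:P\to\mathbb{R}$ be positive definite. Then: (i) $f(x)\geq 0$ for all $x\in P$; (ii) $f(x)\leq f(y)$ for all $x,y\in P$ with $x\preceq y$.
   Context: A meet semilattice $(P,\preceq,\wedge)$ is a nonempty poset in which every two elements $x,y$ have a greatest lower bound $x\wedge y$. For a finite nonempty set $S=\{x_1,\ldots,x_n\}\subset P$ and $f:P\to\mathbb{R}$, the meet matrix $(S)_f$ is the $n\times n$ real matrix with entries $((S)_f)_{i,j}=f(x_i\wedge x_j)$. The function $f$ is called positive definite if $(S)_f$ is positive semidefinite for every finite nonempty $S\subset P$. *)

(* Defs.v *)
From HB Require Import structures.
From mathcomp Require Import all_boot all_order all_algebra.
From mathcomp Require Import reals.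

Set Implicit Arguments.
Unset Strict Implicit.
Unset Printing Implicit Defensive.

Import Order.TTheory GRing.Theory Num.Theory.
Local Open Scope ring_scope.

Definition meet_mx (d : Order.disp_t) (P : meetSemilatticeType d)
    (R : realType) (f : P -> R) (n : nat) (x : 'I_n -> P) : 'M[R]_n :=
  \matrix_(i, j) f (Order.meet (x i) (x j)).

Definition psdmx (R : realType) (n : nat) (A : 'M[R]_n) : Prop :=
  A^T = A /\ forall v : 'cV[R]_n, 0 <= (v^T *m A *m v) 0 0.

(* A finite nonempty set S = {x_1, ..., x_n} is given by an enumeration
   x : 'I_n -> P without repetition, n > 0. *)
Definition positive_definite_fun (d : Order.disp_t) (P : meetSemilatticeType d)
    (R : realType) (f : P -> R) : Prop :=
  forall (n : nat) (x : 'I_n -> P),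
    (0 < n)%N -> injective x -> psdmx (meet_mx f x).

(* Main.v *)
Require Import Defs.
From mathcomp Require Import all_boot all_order all_algebra.
From mathcomp Require Import reals.

Import Order.TTheory GRing.Theory Num.Theory.
Local Open Scope ring_scope.

(** The 1 x 1 meet matrix of {x} is (f x). If x < y then the meet matrix of
    {x, y} is [[f x, f x], [f x, f y]], and its quadratic form takes the value
    f y - f x at the vector (1, -1). *)

Theorem theorem2p8 (R : realType) (d : Order.disp_t)
    (P : meetSemilatticeType d) (P_nonempty : inhabited P) (f : P -> R)
    (f_pd : positive_definite_fun f) :
  (forall x : P, 0 <= f x) /\
  (forall x y : P, (x <= y)%O -> f x <= f y).
Proof.
split=> [x|x y le_xy].
  have inj_x : injective (fun _ : 'I_1 => x) by move=> i j _; rewrite !ord1.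
  (* The 1 x 1 identity serves as the test vector (1), where the form equals [f] of the meet of [x]
     with itself. *)
  have [_ /(_ 1%:M)] := f_pd 1%N _ isT inj_x.
  by rewrite trmx1 mul1mx mulmx1 mxE meetxx.
(* An enumeration of {x, y} by ['I_2] is injective only if [x] and [y] differ, so equality is
   settled apart, by reflexivity. *)
have [-> //|neq_xy] := eqVneq x y.
pose s (i : 'I_2) := if i == 0 then x else y.
have inj_s : injective s.
  move=> i j; rewrite /s; case: i j => [[|[|//]] ?] [[|[|//]] ?] /= e;
    apply/val_inj => //=; by rewrite e eqxx in neq_xy.
have [_ /(_ (\col_i (if i == 0 then 1 else -1)))] := f_pd 2%N s isT inj_s.
rewrite !mxE big_ord_recl big_ord1 !mxE !big_ord_recl !big_ord0 !mxE /s /=.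
rewrite !meetxx (meet_l le_xy) (meet_r le_xy).
(* The row (1, -1) times the matrix is (0, f x - f y): [subrr] kills the first entry, and the second
   is multiplied by -1. *)
by rewrite !mul1r !mulN1r !mulr1 !mulrN1 !addr0 subrr add0r opprD opprK addrC subr_ge0.
Qed.
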